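(* Let $\mathfrak p$ be any dyadic prime of any number field $F$. There is no classic $2$-universal quaternary (rank $4$) lattice over the dyadic local field $F_{\mathfrak p}$ (i.e. no classic $2$-universal $\mathcal{O}_{\mathfrak p}$-lattice of rank $4$).
   Context: $F_{\mathfrak p}$ is the completion of $F$ at $\mathfrak p$ and $\mathcal{O}_{\mathfrak p}$ its valuation ring; dyadic means $\mathfrak p\mid 2$. Quadratic spaces are finite-dimensional over $F_{\mathfrak p}$ with a non-degenerate symmetric bilinear form $B$, $Q(x)=B(x,x)$. An $\mathcal{O}_{\mathfrak p}$-lattice is a finitely generated $\mathcal{O}_{\mathfrak p}$-submodule of a quadratic space, regarded as spanning a non-degenerate space; it is classic integral if $B(L,L)\subseteq\mathcal{O}_{\mathfrak p}$. $L$ is represented by $M$ if there is a linear map $\sigma$ from the span of $L$ to the span of $M$, preserving the quadratic forms, with $\sigma(L)\subseteq M$. A classic integral $\mathcal{O}_{\mathfrak p}$-lattice is classic $2$-universal if it represents all classic integral $\mathcal{O}_{\mathfrak p}$-lattices of rank $2$. *)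

(* Defs.v *)
From HB Require Import structures.
From mathcomp Require Import all_boot all_order all_algebra all_field.

Set Implicit Arguments.
Unset Strict Implicit.
Unset Printing Implicit Defensive.

Import Order.TTheory GRing.Theory Num.Theory.
Local Open Scope ring_scope.

(* A number field is a finite extension of the rationals, i.e. a
   [fieldExtType rat].  Subsets of fields and of vector spaces (rings of
   integers, ideals, lattices) are [Prop]-valued predicates. *)

Definition ring_of_integers (F : fieldExtType rat) (x : F) : Prop :=
  integralOver (intr : int -> F) x.

(* The nonzero prime ideals of the ring of integers of F. *)
Record prime_of (F : fieldExtType rat) (p : F -> Prop) : Prop := PrimeOf {
  prime_sub : forall x, p x -> ring_of_integers x;
  prime_0 : p 0;
  prime_add : forall x y, p x -> p y -> p (x + y);
  prime_mul : forall a x, ring_of_integers a -> p x -> p (a * x);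
  prime_proper : ~ p 1;
  prime_prime : forall x y, ring_of_integers x -> ring_of_integers y ->
    p (x * y) -> p x \/ p y;
  prime_neq0 : exists2 x, p x & x != 0
}.

(* p divides 2: in a Dedekind domain, to divide is to contain. *)
Definition dyadic (F : fieldExtType rat) (p : F -> Prop) : Prop := p 2.

Definition ideal_mul (F : fieldExtType rat) (I J : F -> Prop) (x : F) : Prop :=
  exists s : seq (F * F),
    (forall ab, ab \in s -> I ab.1 /\ J ab.2) /\
    x = \sum_(ab <- s) ab.1 * ab.2.

Definition ideal_exp (F : fieldExtType rat) (I : F -> Prop) (n : nat) :
    F -> Prop :=
  iter n (ideal_mul I) (@ring_of_integers F).

(* Discrete valuations are total functions to [int] whose value at 0 is
   irrelevant; [val_ge v n x] means v(x) >= n with the convention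
   v(0) = +oo. *)
Definition val_ge (K : fieldType) (v : K -> int) (n : int) (x : K) : Prop :=
  x = 0 \/ n <= v x.

Record valuation (K : fieldType) (v : K -> int) : Prop := Valuation {
  val_mul : forall x y, x != 0 -> y != 0 -> v (x * y) = v x + v y;
  val_add : forall n x y,
    val_ge v n x -> val_ge v n y -> val_ge v n (x + y)
}.

Definition val_ring (K : fieldType) (v : K -> int) (x : K) : Prop :=
  val_ge v 0 x.

(* v = ord_p: on a nonzero algebraic integer x, v(x) is the exponent of the
   largest power of p containing x. *)
Record padic_valuation (F : fieldExtType rat) (p : F -> Prop) (v : F -> int) :
    Prop := PadicValuation {
  padic_val : valuation v;
  padic_exp : forall x (n : nat), ring_of_integers x -> x != 0 ->
    (ideal_exp p n x <-> n%:Z <= v x)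
}.

Definition val_cauchy (K : fieldType) (v : K -> int) (u : nat -> K) : Prop :=
  forall n : int, exists N : nat, forall i j : nat,
    (N <= i)%N -> (N <= j)%N -> val_ge v n (u i - u j).

Definition val_cvg (K : fieldType) (v : K -> int) (u : nat -> K) (l : K) :
    Prop :=
  forall n : int, exists N : nat, forall i : nat,
    (N <= i)%N -> val_ge v n (u i - l).

(* (K, w) together with iota is the completion of (F, v). *)
Record completion (F : fieldType) (v : F -> int)
    (K : fieldType) (iota : {rmorphism F -> K}) (w : K -> int) : Prop :=
  Completion {
  compl_val : valuation w;
  compl_ext : forall x, x != 0 -> w (iota x) = v x;
  compl_dense : forall (x : K) (n : int),
    exists y : F, val_ge w n (x - iota y);
  compl_complete : forall u, val_cauchy w u -> exists l, val_cvg w u l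
}.

(* A lattice over the valuation ring of v: a finitely generated submodule of
   a non-degenerate quadratic space which it spans. *)
Record lattice (K : fieldType) (v : K -> int) := Lattice {
  lat_space : vectType K;
  lat_form : {symmetric lat_space};
  lat_mem :> lat_space -> Prop;
  lat_nondegenerate : nondegenerate lat_form;
  lat_fin_gen : exists s : seq lat_space,
    <<s>>%VS = fullv /\
    forall x, lat_mem x <->
      exists a : nat -> K, (forall i, val_ring v (a i)) /\
        x = \sum_(i < size s) a i *: s`_i
}.

Definition lat_rank (K : fieldType) (v : K -> int) (L : lattice v) : nat :=
  \dim {: lat_space L}.

Definition lat_Q (K : fieldType) (v : K -> int) (L : lattice v)
    (x : lat_space L) : K :=
  lat_form L x x.

Definition classic_integral (K : fieldType) (v : K -> int) (L : lattice v) :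
    Prop :=
  forall x y, L x -> L y -> val_ring v (lat_form L x y).

Definition represented_by (K : fieldType) (v : K -> int) (L M : lattice v) :
    Prop :=
  exists sigma : {linear lat_space L -> lat_space M},
    (forall x, lat_Q (sigma x) = lat_Q x) /\
    (forall x, L x -> M (sigma x)).

Definition classic_universal (K : fieldType) (v : K -> int) (n : nat)
    (M : lattice v) : Prop :=
  classic_integral M /\
  forall L : lattice v,
    classic_integral L -> lat_rank L = n -> represented_by L M.

(* Main.v *)
(** A rank 4 classic 2-universal lattice M splits off a hyperbolic plane, so its
   space is H + <a, -a d>, where the unit a is the norm of a vector of M.
   Representing suitably scaled lattices <a c, -a c d> forces every c to be a
   norm x^2 - d y^2: move the vector of norm a c into H by a reflection and
   compare what is left.  Let rho be such that X^2 + X - rho has no root in the residue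
   field; the norms from the unramified extension of discriminant 1 + 4 rho have
   even valuation, hence d is, up to squares, neither 1 + 4 rho, nor of
   valuation 1, nor of the form 1 + delta with delta of valuation 1.
   If 2 is not a uniformizer, representing a uniformizer forces d to be of one
   of the last two types.  If 2 is a uniformizer, the only remaining possibility is
   that d is a square, and the space of M contains a totally isotropic plane;
   but M also contains the even lattice of Gram matrix [[2, 1], [1, - 2 rho]]
   and, orthogonally to it, a vector of unit norm, and these span an anisotropic
   hyperplane since their nonzero norms have valuations of opposite parities. *)

From HB Require Import structures.
Require Import Defs.
From mathcomp Require Import all_boot all_order all_algebra all_field.
From mathcomp Require Import ring zify.
From Stdlib Require Import Classical.

Set Implicit Arguments.
Unset Strict Implicit.
Unset Printing Implicit Defensive.

Import Order.TTheory GRing.Theory Num.Theory.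
Local Open Scope ring_scope.

(** * Elementary facts on discrete valuations *)

Section ValuationTheory.
Variables (K : fieldType) (u : K -> int).
Hypothesis hu : valuation u.
Implicit Types (x y z : K) (m n : int).

Lemma val_geW m n x : m <= n -> val_ge u n x -> val_ge u m x.
Proof. by move=> le_mn [->|h]; [left | right; apply: le_trans le_mn h]. Qed.

Lemma val_1 : u 1 = 0.
Proof.
have h : u (1 * 1) = u 1 + u 1 by rewrite (val_mul hu) ?oner_eq0.
by rewrite mulr1 in h; lia.
Qed.

Lemma val_N1 : u (-1) = 0.
Proof.
have n1 : -1 != 0 :> K by rewrite oppr_eq0 oner_eq0.
by have := val_mul hu n1 n1; rewrite mulrNN mulr1 val_1; lia.
Qed.

Lemma val_N x : u (- x) = u x.
Proof.
have n1 : -1 != 0 :> K by rewrite oppr_eq0 oner_eq0.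
have [->|x0] := eqVneq x 0; first by rewrite oppr0.
by rewrite -mulN1r (val_mul hu n1 x0) val_N1 add0r.
Qed.

Lemma val_V x : x != 0 -> u x^-1 = - u x.
Proof.
move=> x0; have := val_mul hu x0 (invr_neq0 x0).
by rewrite divff // val_1; lia.
Qed.

Lemma val_div x y : x != 0 -> y != 0 -> u (x / y) = u x - u y.
Proof. by move=> x0 y0; rewrite (val_mul hu x0 (invr_neq0 y0)) val_V. Qed.

Lemma val_sqr x : x != 0 -> u (x ^+ 2) = u x + u x.
Proof. by move=> x0; rewrite expr2 (val_mul hu x0 x0). Qed.

Lemma val_exp x k : x != 0 -> u (x ^+ k) = u x * k%:Z.
Proof.
move=> x0; elim: k => [|k IHk]; first by rewrite expr0 val_1 mulr0.
by rewrite exprS (val_mul hu x0) ?expf_neq0 // IHk; lia.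
Qed.

Lemma val_expz x (k : int) : x != 0 -> u (x ^ k) = u x * k.
Proof.
move=> x0; case: k => k; first exact: val_exp.
by rewrite NegzE -exprnN val_V ?expf_neq0 // val_exp // mulrN.
Qed.

Lemma val_geN n x : val_ge u n x -> val_ge u n (- x).
Proof. by case=> [->|h]; [left; rewrite oppr0 | right; rewrite val_N]. Qed.

Lemma val_geB n x y : val_ge u n x -> val_ge u n y -> val_ge u n (x - y).
Proof. by move=> hx /val_geN; apply: (val_add hu). Qed.

Lemma val_geM m n x y : val_ge u m x -> val_ge u n y -> val_ge u (m + n) (x * y).
Proof.
have [->|x0] := eqVneq x 0; first by left; rewrite mul0r.
have [->|y0] := eqVneq y 0; first by left; rewrite mulr0.
case=> [/eqP|hx]; first by rewrite (negPf x0).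
case=> [/eqP|hy]; first by rewrite (negPf y0).
by right; rewrite (val_mul hu x0 y0) lerD.
Qed.

Lemma val_ge_neq0 n x : x != 0 -> val_ge u n x <-> n <= u x.
Proof.
by move=> x0; split=> [[/eqP|//]|]; [rewrite (negPf x0) | right].
Qed.

(** If x + y had valuation larger than u x, so would x = (x + y) - y. *)
Lemma val_addl x y : x != 0 -> val_ge u (u x + 1) y ->
  x + y != 0 /\ u (x + y) = u x.
Proof.
move=> x0 hy.
have hx' : ~ val_ge u (u x + 1) x by rewrite val_ge_neq0 //; lia.
have nhxy : ~ val_ge u (u x + 1) (x + y).
  by move=> hxy; apply: hx'; have := val_geB hxy hy; rewrite addrK.
have xy0 : x + y != 0 by apply/eqP => e; apply: nhxy; left.
split=> //.
have : val_ge u (u x) (x + y).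
  by apply: (val_add hu); [right | apply: val_geW hy; lia].
by move: nhxy; rewrite !val_ge_neq0 //; lia.
Qed.

Lemma val_ring1 : val_ring u 1.
Proof. by right; rewrite val_1. Qed.

Lemma val_ringM x y : val_ring u x -> val_ring u y -> val_ring u (x * y).
Proof. exact: val_geM. Qed.

Lemma val_ringX x k : val_ring u x -> val_ring u (x ^+ k).
Proof.
move=> hx; elim: k => [|k IHk]; first exact: val_ring1.
by rewrite exprS; apply: val_ringM.
Qed.

Lemma val_ringMl n x y : val_ring u x -> val_ge u n y -> val_ge u n (x * y).
Proof. by move=> hx hy; rewrite -[n]add0r; apply: val_geM. Qed.

Lemma val_ringMr n x y : val_ge u n x -> val_ring u y -> val_ge u n (x * y).
Proof. by move=> hx hy; rewrite -[n]addr0; apply: val_geM. Qed.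

Lemma val_ge_nat k : val_ring u k%:R.
Proof.
elim: k => [|k IHk]; first by left.
by rewrite -natr1; apply: (val_add hu) => //; apply: val_ring1.
Qed.

Lemma val_ge_sqr x : val_ge u 1 (x ^+ 2) -> val_ge u 1 x.
Proof.
have [->|x0] := eqVneq x 0; first by left.
by rewrite !val_ge_neq0 ?expf_neq0 // val_sqr //; lia.
Qed.

Lemma val_ge_sum n (I : Type) (r : seq I) (P : pred I) (E : I -> K) :
  (forall i, P i -> val_ge u n (E i)) -> val_ge u n (\sum_(i <- r | P i) E i).
Proof.
move=> hE; elim/big_rec: _ => [|i x Pi hx]; first by left.
by apply: (val_add hu) => //; apply: hE.
Qed.

Lemma val_unit x : val_ring u x -> ~ val_ge u 1 x -> x != 0 /\ u x = 0.
Proof.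
move=> hx h'x.
have x0 : x != 0 by apply/eqP => e; apply: h'x; left.
by split=> //; move: hx h'x; rewrite /val_ring !val_ge_neq0 //; lia.
Qed.

Lemma val_unitD x y : x != 0 -> u x = 0 -> val_ge u 1 y ->
  x + y != 0 /\ u (x + y) = 0.
Proof. by move=> x0 ux hy; rewrite -ux; apply: val_addl; rewrite ?ux. Qed.

Lemma val_1D y : val_ge u 1 y -> 1 + y != 0 /\ u (1 + y) = 0.
Proof. by apply: val_unitD; rewrite ?oner_eq0 ?val_1. Qed.

End ValuationTheory.


(** * Norm forms x^2 - d y^2 at a dyadic valuation *)

Definition even_val (K : fieldType) (u : K -> int) (x : K) : Prop :=
  x != 0 /\ exists k : int, u x = k + k.

(* The polynomial [X^2 + X - rho] has no root in the residue field. *)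
Definition artin_schreier (K : fieldType) (u : K -> int) (rho : K) : Prop :=
  val_ring u rho /\ forall x, val_ring u x -> ~ val_ge u 1 (x ^+ 2 + x - rho).

Section DyadicTheory.
Variables (K : fieldType) (u : K -> int).
Hypothesis hu : valuation u.
Implicit Types (x y z : K).

(** Divide by the square of the variable of smaller valuation. If t = x / y is integral, t^2 + t -
    rho is a unit by the choice of rho; if y / x is in the maximal ideal, the cofactor is 1 plus a
    non-unit. *)
Lemma artin_schreier_form_even rho x y : artin_schreier u rho ->
  (x != 0) || (y != 0) -> even_val u (x ^+ 2 + x * y - rho * y ^+ 2).
Proof.
move=> [hrho hAS].
have [[y0 hxy] _|] := classic (y != 0 /\ val_ge u (u y) x).
  have ht : val_ring u (x / y).
    have [->|x0] := eqVneq x 0; first by left; rewrite mul0r.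
    by right; rewrite (val_div hu) //; move/(val_ge_neq0 _ _ x0): hxy; lia.
  have [N0 uN] : (x / y) ^+ 2 + x / y - rho != 0 /\
                 u ((x / y) ^+ 2 + x / y - rho) = 0.
    apply: (val_unit _ (hAS _ ht)).
    apply: (val_geB hu) => //; apply: (val_add hu) => //.
    exact: (val_ringX hu).
  have -> : x ^+ 2 + x * y - rho * y ^+ 2 =
            y ^+ 2 * ((x / y) ^+ 2 + x / y - rho) by field.
  split; first by rewrite mulf_neq0 ?expf_neq0.
  by exists (u y); rewrite (val_mul hu) ?expf_neq0 // uN addr0 (val_sqr hu).
move=> nyx hxy.
have x0 : x != 0.
  apply/eqP => x0; apply: nyx; rewrite x0 eqxx /= in hxy *.
  by split=> //; left.
have ht : val_ge u 1 (y / x).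
  have [->|y0] := eqVneq y 0; first by left; rewrite mul0r.
  right; rewrite (val_div hu) //.
  have : ~ val_ge u (u y) x by move=> h; apply: nyx.
  by rewrite val_ge_neq0 //; lia.
have [N0 uN] : 1 + (y / x - rho * (y / x) ^+ 2) != 0 /\
               u (1 + (y / x - rho * (y / x) ^+ 2)) = 0.
  apply: (val_1D hu); apply: (val_geB hu) => //.
  apply: (val_ringMl hu) => //; rewrite expr2; apply: (val_ringMr hu) => //.
  exact: val_geW ht.
have -> : x ^+ 2 + x * y - rho * y ^+ 2 =
          x ^+ 2 * (1 + (y / x - rho * (y / x) ^+ 2)) by field.
split; first by rewrite mulf_neq0 ?expf_neq0.
by exists (u x); rewrite (val_mul hu) ?expf_neq0 // uN addr0 (val_sqr hu).
Qed.

Hypotheses (two_neq0 : 2 != 0 :> K) (val_2 : 1 <= u 2).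

Lemma val_ge_2 : val_ge u 1 2.
Proof. by right. Qed.

Lemma four_neq0 : 4 != 0 :> K.
Proof. by rewrite (natrM _ 2 2) mulf_neq0. Qed.

Lemma val_4 : u 4 = u 2 + u 2.
Proof. by rewrite (natrM _ 2 2) (val_mul hu). Qed.

(** The substitution X = x - y, Y = 2 y reduces this to the form X^2 + X Y - rho Y^2. *)
Lemma unramified_norm_even rho x y : artin_schreier u rho ->
  (x != 0) || (y != 0) -> even_val u (x ^+ 2 - (1 + 4 * rho) * y ^+ 2).
Proof.
move=> hAS hxy.
have -> : x ^+ 2 - (1 + 4 * rho) * y ^+ 2 =
  (x - y) ^+ 2 + (x - y) * (2 * y) - rho * (2 * y) ^+ 2 by ring.
apply: artin_schreier_form_even => //.
have [y0|y0] := eqVneq y 0; last by rewrite [2 * y != 0]mulf_neq0 ?orbT.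
by move: hxy; rewrite y0 subr0 eqxx orbF => ->.
Qed.

(** Over a local field of characteristic other than 2 this holds exactly for the nonzero squares;
    the lemmas below exclude three kinds of d by elementary means. *)
Definition norm_universal d : Prop :=
  forall c : K, c != 0 -> exists x y, c = x ^+ 2 - d * y ^+ 2.

Lemma norm_universalM d s : norm_universal (d * s ^+ 2) -> norm_universal d.
Proof.
by move=> hd c /hd [x [y ->]]; exists x, (s * y); ring.
Qed.

Lemma norm_universal_mul d s : s != 0 -> norm_universal d ->
  norm_universal (d * s ^+ 2).
Proof.
by move=> s0 hd c /hd [x [y ->]]; exists x, (y / s); field.
Qed.

(** If 1 + 4 rho = x^2 - d y^2, then d y^2 = x^2 - (1 + 4 rho) is an unramified norm of odd
    valuation. *)
Lemma not_norm_universal_prime rho d : artin_schreier u rho -> d != 0 ->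
  u d = 1 -> ~ norm_universal d.
Proof.
move=> hAS d0 ud hd.
have D0 : 1 + 4 * rho != 0.
  have [] := @unramified_norm_even rho 0 1 hAS; first by rewrite oner_eq0 orbT.
  by rewrite expr0n expr1n mulr1 sub0r oppr_eq0.
have [x [y hxy]] := hd _ D0.
have [|N0 [k uN]] := @unramified_norm_even rho x 1 hAS.
  by rewrite oner_eq0 orbT.
have e : x ^+ 2 - (1 + 4 * rho) * 1 ^+ 2 = d * y ^+ 2 by rewrite hxy; ring.
rewrite e in N0 uN.
have y0 : y != 0 by apply: contraNneq N0 => ->; rewrite expr0n mulr0.
by move: uN; rewrite (val_mul hu) ?expf_neq0 // (val_sqr hu) // ud; lia.
Qed.

(* With [a = 1 + delta] and [b = 4 rho - delta], so that [a + b] is the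
   discriminant [1 + 4 rho], the value [- b / delta] is not a norm: otherwise
   [- delta = 1 - a] being one, [b] would be a norm too, and the form
   [a y^2 + b z^2], which represents [a + b], would show [a b] to be of even
   valuation. *)
Lemma not_norm_universal_unit rho delta : artin_schreier u rho ->
  delta != 0 -> u delta = 1 -> ~ norm_universal (1 + delta).
Proof.
move=> hAS delta0 udelta hd.
have [a0 ua] : 1 + delta != 0 /\ u (1 + delta) = 0.
  by apply: (val_1D hu); right; rewrite udelta.
have [b0 ub] : - delta + 4 * rho != 0 /\ u (- delta + 4 * rho) = 1.
  have := @val_addl _ _ hu (- delta) (4 * rho).
  rewrite oppr_eq0 (val_N hu) udelta; apply=> //.
  apply: (val_ringMr hu); last by case: hAS.
  by right; rewrite val_4; move: val_2; lia.
have c0 : - (- delta + 4 * rho) / delta != 0.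
  by rewrite mulf_neq0 ?oppr_eq0 ?invr_eq0.
have [x [y hxy]] := hd _ c0.
(* Coordinates of (x + y sqrt a)(1 + sqrt a), where 1 + sqrt a has norm 1 - a = - delta. *)
set X := x + (1 + delta) * y; set Y := x + y.
have hb : - delta + 4 * rho = X ^+ 2 - (1 + delta) * Y ^+ 2.
  have -> : - delta + 4 * rho =
            - delta * (- (- delta + 4 * rho) / delta) by field.
  by rewrite hxy /X /Y; ring.
(* With X^2 = a Y^2 + b, this is the identity (a + b)(a Y^2 + b) = (a Y + b)^2 + a b (Y - 1)^2. *)
have key : (1 + delta) * (- delta + 4 * rho) * (Y - 1) ^+ 2 =
   - (((1 + delta) * Y + (- delta + 4 * rho)) ^+ 2 - (1 + 4 * rho) * X ^+ 2).
  have -> : X ^+ 2 = - delta + 4 * rho + (1 + delta) * Y ^+ 2.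
    by rewrite [in RHS]hb; ring.
  by ring.
(* For Y = 1, X^2 = a + b = 1 + 4 rho, so a nontrivial unramified norm would vanish. *)
have [Y1|Y1] := eqVneq Y 1.
  have [|] := @unramified_norm_even rho X 1 hAS; first by rewrite oner_eq0 orbT.
  have -> : X ^+ 2 = X ^+ 2 - (1 + delta) * Y ^+ 2 + (1 + delta).
    by rewrite Y1; ring.
  rewrite -hb.
  have -> : - delta + 4 * rho + (1 + delta) - (1 + 4 * rho) * 1 ^+ 2 = 0 by ring.
  by rewrite eqxx.
have Y1' : Y - 1 != 0 by rewrite subr_eq0.
have l0 : (1 + delta) * (- delta + 4 * rho) * (Y - 1) ^+ 2 != 0.
  by rewrite !mulf_neq0 ?expf_neq0.
have ul : u ((1 + delta) * (- delta + 4 * rho) * (Y - 1) ^+ 2) =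
          1 + (u (Y - 1) + u (Y - 1)).
  rewrite (val_mul hu) ?mulf_neq0 ?expf_neq0 // (val_sqr hu) //.
  by rewrite (val_mul hu) // ua ub add0r.
rewrite key in l0 ul.
have [|_ [k uN]] := @unramified_norm_even rho
  ((1 + delta) * Y + (- delta + 4 * rho)) X hAS.
  apply: contraNT l0; rewrite negb_or !negbK => /andP[/eqP-> /eqP->].
  by rewrite expr0n mulr0 subrr oppr0.
by move: ul; rewrite (val_N hu) uN; lia.
Qed.

Lemma not_norm_universal_unramified rho pi : artin_schreier u rho ->
  pi != 0 -> u pi = 1 -> ~ norm_universal (1 + 4 * rho).
Proof.
move=> hAS pi0 upi /(_ _ pi0)[x [y hxy]].
have [|_ [k]] := @unramified_norm_even rho x y hAS; last by rewrite -hxy upi; lia.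
apply: contraNT pi0; rewrite negb_or !negbK hxy => /andP[/eqP-> /eqP->].
by rewrite expr0n mulr0 subrr.
Qed.

(** * Universal norm forms when 2 is a uniformizer *)

Section Complete.
Variables (pi rho : K).
Hypotheses (pi_neq0 : pi != 0) (val_pi : u pi = 1).
Hypothesis rho_AS : artin_schreier u rho.
Hypothesis perfect : forall x, val_ring u x ->
  exists2 y, val_ring u y & val_ge u 1 (x - y ^+ 2).
Hypothesis henselian : forall x, val_ge u 1 x ->
  exists2 y, val_ge u 1 y & y ^+ 2 + y = x.

(** Square factors are removed step by step. Odd valuation is excluded; a unit is a square times 1 +
    delta because the residue field is perfect; apart from the excluded case u delta = 1, delta = 4
    t with t integral because u 2 = 1. *)
Lemma square_of_norm_universal d : u 2 = 1 -> d != 0 -> norm_universal d ->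
  exists r, d = r ^+ 2.
Proof.
move=> u2 d0 hd.
pose k := (u d %/ 2)%Z; pose s := pi ^ k.
have s0 : s != 0 by rewrite expfz_neq0.
have us : u s = k by rewrite (val_expz hu) // val_pi mul1r.
set d1 := d / s ^+ 2.
have dE : d = d1 * s ^+ 2 by rewrite /d1; field.
have d10 : d1 != 0 by rewrite mulf_neq0 ?invr_eq0 ?expf_neq0.
have hd1 : norm_universal d1 by apply: (@norm_universalM d1 s); rewrite -dE.
have [ud1|ud1] : u d1 = 1 \/ u d1 = 0.
- rewrite (val_div hu) ?expf_neq0 // (val_sqr hu) // us /k.
  have := divz_eq (u d) 2; have := ltz_pmod (u d) (isT : 0 < 2 :> int).
  have := modz_ge0 (u d) (isT : 2 != 0 :> int).
  lia.
- by case: (not_norm_universal_prime rho_AS d10 ud1 hd1).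
have [|r hr hdr] := perfect (x := d1); first by right; rewrite ud1.
have r2N : r ^+ 2 != 0 /\ u (r ^+ 2) = 0.
  have := @val_unitD _ _ hu d1 (- (d1 - r ^+ 2)) d10 ud1 (val_geN hu hdr).
  by rewrite opprB addrC subrK.
have r0 : r != 0 by case: r2N => + _; apply: contraNneq => ->; rewrite expr0n.
set delta := (d1 - r ^+ 2) / r ^+ 2.
have d1E : d1 = (1 + delta) * r ^+ 2 by rewrite /delta; field.
have hdelta : val_ge u 1 delta.
  apply: (val_ringMr hu) => //; right; rewrite (val_V hu); last by case: r2N.
  by case: r2N => _ ->.
have hd2 : norm_universal (1 + delta).
  by apply: (@norm_universalM _ r); rewrite -d1E.
have [udelta|nudelta] := classic (delta != 0 /\ u delta = 1).
  by case: udelta => *; case: (@not_norm_universal_unit rho delta).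
pose t := delta / 4.
have deltaE : delta = 4 * t by rewrite /t; field; apply: four_neq0.
have ht : val_ring u t.
  rewrite /t; have [->|delta0] := eqVneq delta 0; first by left; rewrite mul0r.
  right; rewrite (val_div hu) ?four_neq0 // val_4 u2.
  move: hdelta; rewrite val_ge_neq0 //.
  have : u delta <> 1 by move=> e; apply: nudelta.
  lia.
(* If X^2 + X - t had no residual root, 1 + 4 t would be an unramified discriminant, which is
   excluded. *)
have [[x hx hxt]|nAS] :=
  classic (exists2 x, val_ring u x & val_ge u 1 (x ^+ 2 + x - t)); last first.
  have tAS : artin_schreier u t by split=> // x hx h; apply: nAS; exists x.
  by rewrite deltaE in hd2; case: (not_norm_universal_unramified tAS pi_neq0 val_pi).
have [a0 ua] : 1 + 2 * x != 0 /\ u (1 + 2 * x) = 0.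
  by apply: (val_1D hu); apply: (val_ringMr hu) => //; apply: val_ge_2.
(* The right-hand side is chosen so that 1 + 4 t = (1 + 2 x)^2 (1 + 4 (y^2 + y)), whose last factor
   is (1 + 2 y)^2. *)
have [|y hy yE] := henselian (x := - (x ^+ 2 + x - t) / (1 + 2 * x) ^+ 2).
  apply: (val_ringMr hu); first exact: (val_geN hu).
  by right; rewrite (val_V hu) ?expf_neq0 // (val_sqr hu) // ua.
exists ((1 + 2 * x) * (1 + 2 * y) * r * s).
rewrite dE d1E deltaE !exprMn; congr (_ * _ * _).
have -> : (1 + 2 * y) ^+ 2 = 1 + 4 * (y ^+ 2 + y) by ring.
by rewrite yE; field.
Qed.

End Complete.

End DyadicTheory.

(** * Quadratic spaces of dimension 4 *)

Section QuadraticSpace.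
Variables (K : fieldType) (V : vectType K) (B : {symmetric V}).
Implicit Types (x y z : V) (a b : K).

Lemma formC x y : B x y = B y x.
Proof. by rewrite hermC expr0 mul1r. Qed.

Lemma formZl a x y : B (a *: x) y = a * B x y.
Proof. exact: linearZl_LR. Qed.

Lemma formZr a x y : B x (a *: y) = a * B x y.
Proof. exact: linearZr_LR. Qed.

Lemma formDl x y z : B (x + y) z = B x z + B y z.
Proof. exact: linearDl. Qed.

Lemma formDr x y z : B x (y + z) = B x y + B x z.
Proof. exact: linearDr. Qed.

Lemma formNl x y : B (- x) y = - B x y.
Proof. exact: linearNl. Qed.

Lemma formNr x y : B x (- y) = - B x y.
Proof. exact: linearNr. Qed.

Lemma form0l x : B 0 x = 0.
Proof. exact: linear0l. Qed.

Definition formE := (formDl, formDr, formNl, formNr, formZl, formZr).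

Hypothesis B_nondeg : nondegenerate B.
Hypothesis dimV : \dim {: V} = 4.

Lemma nondegenerate_eq0 x : (forall y, B x y = 0) -> x = 0.
Proof.
move=> hx; apply/eqP; rewrite -memv0 -(eqP B_nondeg).
by apply/mem_orthovP => y _; apply: hx.
Qed.

(** Take [v] outside the span of [p], [q], [r] and subtract its orthogonal projection. The result is
    anisotropic, as otherwise it would be orthogonal to the whole space. *)
Lemma orthogonal_fourth p q r :
  B p p * B q q - B p q ^+ 2 != 0 -> B p r = 0 -> B q r = 0 -> B r r != 0 ->
  exists z, [/\ B p z = 0, B q z = 0, B r z = 0, B z z != 0 & forall x,
    exists a b, x = a *: p + b *: q + (B x r / B r r) *: r + (B x z / B z z) *: z].
Proof.
move=> D0 pr qr r0; set D := _ - _ in D0.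
have [v hv] : exists v, v \notin <<[:: p; q; r]>>%VS.
  have : ~~ ({:V} <= <<[:: p; q; r]>>)%VS.
    apply/negP => /dimvS; rewrite dimV => h.
    by have := leq_trans h (dim_span _).
  by move/subvPn => [v _ hv]; exists v.
(* Cramer's rule for the projection of [v] to the plane of [p] and [q]. *)
pose a := (B q q * B v p - B p q * B v q) / D.
pose b := (B p p * B v q - B p q * B v p) / D.
pose w := a *: p + b *: q + (B v r / B r r) *: r.
have [z zE] : exists z, z = v - w by exists (v - w).
have wp : w \in <<[:: p; q; r]>>%VS.
  by rewrite /w !memvD ?memvZ // memv_span // !inE eqxx ?orbT.
have z0 : z != 0 by apply: contraNneq hv; rewrite zE => /subr0_eq ->.
have qp : B q p = B p q by rewrite formC.
have rp : B r p = 0 by rewrite formC.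
have rq : B r q = 0 by rewrite formC.
have zp : B z p = 0.
  by rewrite zE !formE rp qp /a /b /D; field; rewrite r0.
have zq : B z q = 0.
  by rewrite zE !formE rq /a /b /D; field; rewrite r0.
have zr : B z r = 0 by rewrite zE !formE pr qr; field.
have pz : B p z = 0 by rewrite formC.
have qz : B q z = 0 by rewrite formC.
have rz : B r z = 0 by rewrite formC.
have indep k0 k1 k2 k3 : k0 *: p + k1 *: q + k2 *: r + k3 *: z = 0 ->
    [/\ k0 = 0, k1 = 0, k2 = 0 & k3 = 0].
  move=> e.
  have e1 x : B (k0 *: p + k1 *: q + k2 *: r + k3 *: z) x = 0.
    by rewrite e form0l.
  have := e1 r; rewrite !formE pr qr zr !mulr0 !add0r addr0 => /eqP.
  rewrite mulf_eq0 (negPf r0) orbF => /eqP k20.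
  have ep := e1 p; have eq := e1 q.
  rewrite !formE rp zp qp !mulr0 !addr0 in ep.
  rewrite !formE rq zq !mulr0 !addr0 in eq.
  have k00 : k0 * D = 0.
    transitivity ((k0 * B p p + k1 * B p q) * B q q -
                  (k0 * B p q + k1 * B q q) * B p q); first by rewrite /D; ring.
    by rewrite ep eq; ring.
  have k10 : k1 * D = 0.
    transitivity ((k0 * B p q + k1 * B q q) * B p p -
                  (k0 * B p p + k1 * B p q) * B p q); first by rewrite /D; ring.
    by rewrite ep eq; ring.
  move/eqP: k00; rewrite mulf_eq0 (negPf D0) orbF => /eqP k00.
  move/eqP: k10; rewrite mulf_eq0 (negPf D0) orbF => /eqP k10.
  move/eqP: e; rewrite k00 k10 k20 !scale0r !add0r scaler_eq0 (negPf z0) orbF.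
  by move/eqP.
have X_free : free [:: p; q; r; z].
  apply/freeP => k; rewrite !big_ord_recl big_ord0 /= addr0 !addrA.
  move/indep => [h0 h1 h2 h3] i.
  case: i => [[|[|[|[|//]]]] hi] /=.
  - by rewrite -[RHS]h0; congr k; apply: val_inj.
  - by rewrite -[RHS]h1; congr k; apply: val_inj.
  - by rewrite -[RHS]h2; congr k; apply: val_inj.
  - by rewrite -[RHS]h3; congr k; apply: val_inj.
have X_basis : basis_of {:V} [:: p; q; r; z].
  by rewrite basisEfree X_free subvf dimV.
have expand x : exists a b c d, x = a *: p + b *: q + c *: r + d *: z.
  have := coord_basis X_basis (memvf x).
  rewrite !big_ord_recl big_ord0 /= addr0 !addrA => e.
  by do 4 eexists; exact: e.
have zz : B z z != 0.
  apply: contraNneq z0 => zz; apply/eqP; apply: nondegenerate_eq0 => x.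
  have [k0 [k1 [k2 [k3 ->]]]] := expand x.
  by rewrite !formE zp zq zr zz !mulr0 !addr0.
exists z; split=> // x; have [k0 [k1 [k2 [k3 ->]]]] := expand x.
exists k0, k1; congr (_ + _ *: _ + _ *: _); rewrite !formE.
  by rewrite pr qr zr; field.
by rewrite pz qz rz; field.
Qed.

(* The reflection in [w] maps [p] to [p0]; one of [p - p0] and [p + p0]
   is anisotropic. *)
Lemma isometry_transitive p p0 q : 2 != 0 :> K -> B p p = B p0 p0 ->
  B p p != 0 -> B p q = 0 ->
  exists q', B q' q' = B q q /\ B p0 q' = 0.
Proof.
move=> two0 pp0 p_neq0 pq.
have refl w : B w w != 0 -> w = p - p0 \/ w = p + p0 ->
    exists q', B q' q' = B q q /\ B p0 q' = 0.
  move=> w0 hw; exists (q - (2 * B q w / B w w) *: w); split.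
    by rewrite !formE [B w q]formC; field.
  case: hw => hw.
    have e1 : B w w = 2 * (B p p - B p p0).
      by rewrite hw !formE [B p0 p]formC -pp0; ring.
    have e2 : B q w = - B p0 q by rewrite hw !formE formC pq formC; ring.
    have e3 : B p0 w = - (B p p - B p p0).
      by rewrite hw !formE [B p0 p]formC -pp0; ring.
    rewrite !formE e1 e2 e3; rewrite e1 mulf_eq0 negb_or in w0.
    by field; case/andP: w0 => _ ->.
  have e1 : B w w = 2 * (B p p + B p p0).
    by rewrite hw !formE [B p0 p]formC -pp0; ring.
  have e2 : B q w = B p0 q by rewrite hw !formE formC pq formC; ring.
  have e3 : B p0 w = B p p + B p p0.
    by rewrite hw !formE [B p0 p]formC -pp0; ring.
  rewrite !formE e1 e2 e3; rewrite e1 mulf_eq0 negb_or in w0.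
  by field; case/andP: w0 => _ ->.
have [wm|wm] := eqVneq (B (p - p0) (p - p0)) 0; last by apply: refl wm _; left.
have [wp|wp] := eqVneq (B (p + p0) (p + p0)) 0; last by apply: refl wp _; right.
case/negP: p_neq0; have : 2 * 2 * B p p = 0.
  have -> : 2 * 2 * B p p = B (p - p0) (p - p0) + B (p + p0) (p + p0).
    by rewrite !formE [B p0 p]formC -pp0; ring.
  by rewrite wm wp addr0.
by move/eqP; rewrite !mulf_eq0 (negPf two0).
Qed.

(** * Spaces that split off a hyperbolic plane *)

Section HyperbolicSplitting.
Variables (f g y z : V).
Hypotheses (ff : B f f = 0) (gg : B g g = 0) (fg : B f g = 1).
Hypotheses (fy : B f y = 0) (gy : B g y = 0) (yy : B y y != 0).
Hypotheses (fz : B f z = 0) (gz : B g z = 0) (yz : B y z = 0).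
Hypothesis zz : B z z != 0.
Hypothesis expand : forall x, exists a b,
  x = a *: f + b *: g + (B x y / B y y) *: y + (B x z / B z z) *: z.
(** The complement of the hyperbolic plane is Q(y) times the form s^2 - d t^2. *)
Let d := - B z z / B y y.

Lemma hyperbolic_norm x :
  B x x = 2 * B x f * B x g +
    B y y * ((B x y / B y y) ^+ 2 - d * (B x z / B z z) ^+ 2).
Proof.
have [a [b xE]] := expand x.
have xf : B x f = b.
  rewrite xE !formE ff [B g f]formC [B y f]formC [B z f]formC fg fy fz; ring.
have xg : B x g = a.
  rewrite xE !formE gg fg [B y g]formC [B z g]formC gy gz; ring.
rewrite {1 2}xE !formE ff gg [B g f]formC [B y f]formC [B z f]formC fg fy fz.
rewrite [B y g]formC [B z g]formC gy gz [B z y]formC yz xf xg /d.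
by field; rewrite yy zz.
Qed.

(* Moving [p] to [p0 = f + (beta / 2) g], the orthogonal complement of [p]
   becomes [<- beta> + <y, z>], so the vector [q] gives
   [Q(y) (s1^2 - d s2^2) = beta (t^2 - d)]. *)
Lemma represented_norm (c : K) p q : 2 != 0 :> K -> c != 0 ->
  B p p = c * B y y -> B q q = - d * (c * B y y) -> B p q = 0 ->
  exists s1 s2 : K, c = s1 ^+ 2 - d * s2 ^+ 2.
Proof.
move=> two0 c0 pp qq pq.
have [[r dr]|nsq] := classic (exists r, d = r ^+ 2).
  have d0 : d != 0 by rewrite mulf_neq0 ?oppr_eq0 ?invr_eq0.
  have r0 : r != 0 by apply: contraNneq d0 => r0; rewrite dr r0 expr0n.
  (* For d = r^2, use c = ((c + 1) / 2)^2 - ((c - 1) / 2)^2. *)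
  exists ((c + 1) / 2), ((c - 1) / (2 * r)); rewrite dr.
  by field; rewrite ?two0 ?r0.
set beta := c * B y y in pp qq.
have beta0 : beta != 0 by rewrite mulf_neq0.
pose p0 := f + (beta / 2) *: g.
have pp0 : B p p = B p0 p0.
  by rewrite pp !formE ff gg [B g f]formC fg; field.
have [|q' [qq' p0q']] := isometry_transitive two0 pp0 _ pq; first by rewrite pp.
move: p0q'; rewrite formC !formE => qf.
have {}qf : B q' f = - (beta / 2) * B q' g.
  by move/eqP: qf; rewrite addr_eq0 mulNr => /eqP.
have := hyperbolic_norm q'; rewrite qq' qq qf.
move: (B q' g) (B q' y / _) (B q' z / _) => t s1 s2 e.
have t0 : t ^+ 2 - d != 0.
  by rewrite subr_eq0; apply/eqP => e'; apply: nsq; exists t.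
have ce : c * (t ^+ 2 - d) = s1 ^+ 2 - d * s2 ^+ 2.
  apply: (mulfI yy); rewrite -[RHS](addKr (2 * (- (beta / 2) * t) * t)) -e.
  by rewrite /beta; field.
(* Coordinates of (s1 + s2 sqrt d) / (t + sqrt d), up to the sign of the second. *)
exists ((s1 * t - d * s2) / (t ^+ 2 - d)), ((s1 - s2 * t) / (t ^+ 2 - d)).
have -> : c = (c * (t ^+ 2 - d)) / (t ^+ 2 - d) by field.
by rewrite ce; field.
Qed.

(* When [d] is a square the space contains a totally isotropic plane, which
   meets every hyperplane. *)
Lemma isotropic_in_hyperplane (r : K) w : d = r ^+ 2 ->
  exists n : V, [/\ n != 0, B n n = 0 & B n w = 0].
Proof.
move=> dr; have [h hE] : exists h, h = r *: y + z by exists (r *: y + z).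
have hh : B h h = 0.
  rewrite hE !formE yz [B z y]formC yz !mulr0 add0r addr0 mulrA -expr2 -dr /d.
  by field.
have fh : B f h = 0 by rewrite hE !formE fy fz; ring.
have hf : B h f = 0 by rewrite formC.
have [fw|fw] := eqVneq (B f w) 0.
  exists f; split=> //; apply/eqP => f0.
  by move/eqP: fg; rewrite f0 form0l eq_sym oner_eq0.
(* [f] and [h] span a totally isotropic plane; this combination is orthogonal to [w]. *)
exists (B h w *: f - B f w *: h); split; last 1 first.
- by rewrite !formE; ring.
- apply/eqP => e.
  have : B (B h w *: f - B f w *: h) z = 0 by rewrite e form0l.
  rewrite hE !formE fz yz => /eqP; rewrite !mulr0 !add0r oppr_eq0 mulf_eq0.
  by rewrite (negPf fw) (negPf zz).
- by rewrite !formE ff fh hf hh; ring.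
Qed.

End HyperbolicSplitting.
End QuadraticSpace.


(** * The contradiction for a lattice over a local ring *)

Section LocalLattice.
Variables (K : fieldType) (u : K -> int).
Hypothesis hu : valuation u.
Hypotheses (two_neq0 : 2 != 0 :> K) (val_2 : 1 <= u 2).
Variables (pi rho : K).
Hypotheses (pi_neq0 : pi != 0) (val_pi : u pi = 1).
Hypothesis rho_AS : artin_schreier u rho.
Hypothesis perfect : forall x, val_ring u x ->
  exists2 y, val_ring u y & val_ge u 1 (x - y ^+ 2).
Hypothesis henselian : forall x, val_ge u 1 x ->
  exists2 y, val_ge u 1 y & y ^+ 2 + y = x.

(** An even power of the uniformizer clears both denominators without changing square classes, so a
    diagonal form can be made classic integral. *)
Lemma square_multiple_integral (a b : K) :
  exists s, [/\ s != 0, val_ring u (a * s ^+ 2) & val_ring u (b * s ^+ 2)].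
Proof.
pose k := (`|u a| + `|u b|)%N.
have pk0 : pi ^+ k != 0 by rewrite expf_neq0.
have upk : u (pi ^+ k) = k by rewrite (val_exp hu) // val_pi mul1r.
have key c : (`|u c| <= k)%N -> val_ring u (c * (pi ^+ k) ^+ 2).
  have [->|c0] := eqVneq c 0; first by left; rewrite mul0r.
  move=> hc; right; rewrite (val_mul hu) ?expf_neq0 //.
  by rewrite (val_sqr hu) // upk; lia.
by exists (pi ^+ k); split=> //; apply: key; rewrite /k; lia.
Qed.

Variables (V : vectType K) (B : {symmetric V}) (M : V -> Prop).
Hypothesis B_nondeg : nondegenerate B.
Hypothesis dimV : \dim {: V} = 4.
Hypothesis M_lin : forall a x y, val_ring u a -> M x -> M y -> M (x + a *: y).
Hypothesis M_int : forall x y, M x -> M y -> val_ring u (B x y).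

(** Representation of the lattice of Gram matrix [[a, b], [b, c]], recorded by the images of a
    basis. *)
Definition represents_binary a b c : Prop :=
  exists p q, [/\ M p, M q, B p p = a, B p q = b & B q q = c].

Lemma not_all_binary :
  ~ (forall a b c, val_ring u a -> val_ring u b -> val_ring u c ->
       a * c - b ^+ 2 != 0 -> represents_binary a b c).
Proof.
move=> M_rep.
have O0 : val_ring u 0 by left.
have O1 : val_ring u 1 by apply: val_ring1 hu.
have ON1 : val_ring u (-1) by apply: (val_geN hu).
have [|f [g [Mf Mg ff fg gg]]] := M_rep 0 1 0 O0 O1 O0.
  by rewrite mul0r sub0r expr1n oppr_eq0 oner_eq0.
have [|x0 [_ [Mx0 _ x00 _ _]]] := M_rep 1 0 1 O1 O0 O1.
  by rewrite mul1r expr0n subr0 oner_eq0.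
have gf : B g f = 1 by rewrite formC.
(* Projection off the hyperbolic plane of [f] and [g]: integrality keeps it in [M], and norms change
   only by multiples of 2. *)
have proj x : M x -> exists x', [/\ M x', B f x' = 0, B g x' = 0 &
    B x' x' = B x x + 2 * (- (B x f * B x g))].
  move=> Mx; exists (x + (- B x g) *: f + (- B x f) *: g); split.
  - have ON v : M v -> val_ring u (- B x v).
      by move=> Mv; apply: (val_geN hu); apply: M_int.
    exact: (M_lin (ON _ Mf) (M_lin (ON _ Mg) Mx Mf) Mg).
  - by rewrite !formE ff fg [B f x]formC; ring.
  - by rewrite !formE gg gf [B g x]formC; ring.
  - by rewrite !formE ff gg fg gf [B g x]formC [B f x]formC; ring.
have [y [My fy gy yE]] := proj _ Mx0.
have [y0 uy] : B y y != 0 /\ u (B y y) = 0.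
  rewrite yE x00; apply: (val_1D hu); apply: (val_ringMr hu).
    by right.
  by apply: (val_geN hu); apply: (val_ringM hu); apply: M_int.
have [|z [fz gz yz z0 expand]] := orthogonal_fourth B_nondeg dimV _ fy gy y0.
  by rewrite ff fg gg mul0r sub0r expr1n oppr_eq0 oner_eq0.
pose d := - B z z / B y y.
have d0 : d != 0 by rewrite mulf_neq0 ?oppr_eq0 ?invr_eq0.
(* Scaled by s^2, the diagonal form with entries c Q(y) and - d c Q(y) is integral, hence
   represented; so c s^2, and with it c, is a norm. *)
have normd : norm_universal d.
  move=> c c0; set a := c * B y y.
  have a0 : a != 0 by rewrite mulf_neq0.
  have [s [s0 as_ das]] := square_multiple_integral a (- d * a).
  have cs0 : c * s ^+ 2 != 0 by rewrite mulf_neq0 ?expf_neq0.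
  have [|p [q [_ _ pp pq qq]]] := M_rep _ _ _ as_ O0 das.
    by rewrite expr0n subr0 !mulf_neq0 ?oppr_eq0 ?expf_neq0 ?invr_eq0.
  have [||x1 [x2 cE]] :=
    represented_norm ff gg fg fy gy y0 fz gz yz z0 expand two_neq0 cs0 _ _ pq.
  - by rewrite pp /a; ring.
  - by rewrite qq -/d /a; ring.
  exists (x1 / s), (x2 / s).
  have -> : c = c * s ^+ 2 / s ^+ 2 by field.
  by rewrite cE -/d; field.
have [u2|u2] : u 2 = 1 \/ 2 <= u 2 by move: val_2; lia.
- have [r dr] := square_of_norm_universal hu two_neq0 val_2 pi_neq0 val_pi
                   rho_AS perfect henselian u2 d0 normd.
  have [rhoO _] := rho_AS.
  have O2 : val_ring u 2 by apply: (val_ge_nat hu).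
  have D0 : 2 * (- (2 * rho)) - 1 ^+ 2 != 0.
    have [|] := @val_1D _ _ hu (4 * rho).
      by apply: (val_ringMr hu) => //; right; rewrite (val_4 hu two_neq0) u2.
    by rewrite -oppr_eq0 => + _; apply: contraNneq => e; apply/eqP; rewrite -e; ring.
  have [|p [q [Mp Mq pp pq qq]]] := M_rep 2 1 (- (2 * rho)) O2 O1 _ D0.
    by apply: (val_geN hu); apply: (val_ringM hu).
  pose D := 2 * (- (2 * rho)) - 1 ^+ 2.
  have uD : val_ring u D^-1.
    have -> : D = - (1 + 4 * rho) by rewrite /D; ring.
    have [|D'0 uD'] := @val_1D _ _ hu (4 * rho).
      by apply: (val_ringMr hu) => //; right; rewrite (val_4 hu two_neq0) u2.
    by right; rewrite (val_V hu) ?oppr_eq0 // (val_N hu) uD'.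
  (* Cramer's rule again: D is a unit, so [x0] is projected off the even lattice with integral
     coefficients, and the norm of [w] stays in 1 + 2 O. *)
  pose a := (- (2 * rho) * B x0 p - B x0 q) / D.
  pose b := (2 * B x0 q - B x0 p) / D.
  have Oxp : val_ring u (B x0 p) by apply: M_int.
  have Oxq : val_ring u (B x0 q) by apply: M_int.
  have Oa : val_ring u a.
    apply: (val_ringM hu) => //; apply: (val_geB hu) => //.
    by apply: (val_ringM hu) => //; apply: (val_geN hu); apply: (val_ringM hu).
  have Ob : val_ring u b.
    apply: (val_ringM hu) => //; apply: (val_geB hu) => //.
    exact: (val_ringM hu).
  have aD : a * D = - (2 * rho) * B x0 p - B x0 q by rewrite divfK.
  have bD : b * D = 2 * B x0 q - B x0 p by rewrite divfK.
  have ea : B x0 p = 2 * a + b.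
    apply: (mulIf D0); rewrite -/D mulrDl -mulrA aD bD /D; ring.
  have eb : B x0 q = a - 2 * rho * b.
    apply: (mulIf D0); rewrite -/D mulrBl -(mulrA (2 * rho)) aD bD /D; ring.
  have qp : B q p = 1 by rewrite formC.
  have [w wE] : exists w, w = x0 - a *: p - b *: q by exists (x0 - a *: p - b *: q).
  have pw : B p w = 0 by rewrite wE !formE pp pq formC ea; ring.
  have qw : B q w = 0 by rewrite wE !formE qp qq formC eb; ring.
  have [w0 uw] : B w w != 0 /\ u (B w w) = 0.
    have -> : B w w = 1 + 2 * (- (a ^+ 2 + a * b - rho * b ^+ 2)).
      rewrite wE !formE x00 pp pq qp qq [B p x0]formC [B q x0]formC ea eb; ring.
    apply: (val_1D hu); apply: (val_ringMr hu); first by right.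
    apply: (val_geN hu); apply: (val_geB hu); last first.
      by apply: (val_ringM hu) => //; apply: (val_ringX hu).
    by apply: (val_add hu); [apply: (val_ringX hu) | apply: (val_ringM hu)].
  have [|z' [pz' qz' wz' z'0 expand']] :=
    orthogonal_fourth B_nondeg dimV _ pw qw w0; first by rewrite pp pq qq.
  (* The isotropic vector [n] is taken in the hyperplane of [p], [q], [w]. *)
  have [n [n0 nn nz']] := isotropic_in_hyperplane ff fg fy y0 fz yz z0 z' dr.
  have [s [t]] := expand' n; rewrite nz' mul0r scale0r addr0.
  move: (B n w / _) => c nE.
  (* As u 2 = 1, a nonzero left side has odd valuation and a nonzero right side an even one. *)
  have e : 2 * (s ^+ 2 + s * t - rho * t ^+ 2) = - (c ^+ 2 * B w w).
    apply/eqP; rewrite -addr_eq0 -nn nE !formE pp pq qp qq.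
    rewrite [B w p]formC [B w q]formC pw qw; apply/eqP; ring.
  have [|st] := boolP ((s != 0) || (t != 0)).
    move=> st; have [N0 [k uN]] := artin_schreier_form_even hu rho_AS st.
    have c0 : c != 0.
      apply: contraNneq N0 => c0; move/eqP: e.
      by rewrite c0 expr0n mul0r oppr0 mulf_eq0 (negPf two_neq0).
    have : u (2 * (s ^+ 2 + s * t - rho * t ^+ 2)) = u (- (c ^+ 2 * B w w)).
      by rewrite e.
    rewrite (val_mul hu) // uN (val_N hu) (val_mul hu) ?expf_neq0 //.
    by rewrite (val_sqr hu) // uw u2; move: (u c); clear; lia.
  move: st; rewrite negb_or !negbK => /andP[/eqP s0 /eqP t0].
  case/negP: n0; move/eqP: e.
  rewrite s0 t0 expr0n !mulr0 addr0 subr0 mulr0 eq_sym oppr_eq0 mulf_eq0.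
  rewrite (negPf w0) orbF sqrf_eq0 => /eqP c0.
  by rewrite nE s0 t0 c0 !scale0r !addr0.
(* Now u 2 is at least 2, so a vector of norm pi keeps a norm of valuation 1 when projected off the
   hyperbolic plane. *)
- have Opi : val_ring u pi by right; rewrite val_pi.
  have [|x [_ [Mx _ xx _ _]]] := M_rep pi 0 1 Opi O0 O1.
    by rewrite mulr1 expr0n subr0.
  have [x' [Mx' fx' gx' x'E]] := proj _ Mx.
  have := hyperbolic_norm ff gg fg fy gy y0 fz gz yz z0 expand x'.
  rewrite [B x' f]formC fx' mulr0 mul0r add0r -/d.
  set X := B x' y / B y y; set Z := B x' z / B z z => e.
  have hX : val_ring u X.
    apply: (val_ringM hu); first exact: M_int.
    by right; rewrite (val_V hu) // uy.
  have [x'0 ux'] : B x' x' != 0 /\ u (B x' x') = 1.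
    rewrite x'E xx -val_pi; apply: (val_addl hu) => //.
    rewrite val_pi; apply: (val_ringMr hu); first by right.
    by apply: (val_geN hu); apply: (val_ringM hu); apply: M_int.
  pose eta := - (B x' x' / B y y).
  have eta0 : eta != 0 by rewrite oppr_eq0 mulf_neq0 ?invr_eq0.
  have ueta : u eta = 1 by rewrite (val_N hu) (val_div hu) // ux' uy.
  (* Up to squares, d is eta + X^2, of valuation 1, if X is a non-unit, and 1 + eta / X^2 otherwise;
     both are excluded. *)
  have dZ : d * Z ^+ 2 = eta + X ^+ 2.
    by rewrite /eta e; field.
  have [hX1|hX1] := classic (val_ge u 1 X).
    have [|eX0 ueX] := @val_addl _ _ hu eta (X ^+ 2) eta0.
      by rewrite ueta; apply: (val_geM hu).
    have Z0 : Z != 0.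
      by move: eX0; rewrite -dZ; apply: contraNneq => ->; rewrite expr0n mulr0.
    apply: (not_norm_universal_prime hu two_neq0 val_2 rho_AS eX0).
      by rewrite ueX.
    by rewrite -dZ; apply: norm_universal_mul.
  have [X0 uX] := val_unit hX hX1.
  apply: (@not_norm_universal_unit _ _ hu two_neq0 val_2 rho (eta / X ^+ 2)) => //.
  - by rewrite mulf_neq0 ?invr_eq0 ?expf_neq0.
  - by rewrite (val_div hu) ?expf_neq0 // (val_sqr hu) // ueta uX.
  have -> : 1 + eta / X ^+ 2 = d * (Z / X) ^+ 2.
    have -> : d * (Z / X) ^+ 2 = (d * Z ^+ 2) / X ^+ 2 by field.
    by rewrite dZ; field.
  apply: norm_universal_mul => //; rewrite mulf_neq0 ?invr_eq0 //.
  have uX2 : u (X ^+ 2) = 0 by rewrite (val_sqr hu) // uX.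
  have X20 : X ^+ 2 != 0 by rewrite expf_neq0.
  have [|eX0 _] := @val_unitD _ _ hu (X ^+ 2) eta X20 uX2.
    by right; rewrite ueta.
  by move: eX0; rewrite addrC -dZ; apply: contraNneq => ->; rewrite expr0n mulr0.
Qed.
End LocalLattice.

(** * Dependence of residues of a number field over the prime field *)

Section RationalResidue.
Variables (F : fieldExtType rat) (v : F -> int).
Hypothesis hv : valuation v.
Hypothesis val_2 : val_ge v 1 2.

Lemma val_int (z : int) : val_ring v z%:~R.
Proof.
case: z => k; first exact: val_ge_nat.
by rewrite NegzE mulrNz; apply: (val_geN hv); apply: val_ge_nat.
Qed.

Lemma int_residue (z : int) : val_ge v 1 (z%:~R - (~~ (2 %| z)%Z)%:R).
Proof.
have zE : z = (z %/ 2)%Z * 2 + (~~ (2 %| z)%Z)%:Z by lia.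
rewrite {1}zE intrD intrM addrK.
by apply: (val_ringMl hv) => //; apply: val_int.
Qed.

Lemma odd_int_unit (z : int) : ~~ (2 %| z)%Z ->
  z%:~R != 0 :> F /\ v z%:~R = 0.
Proof.
move=> oz; have := int_residue z; rewrite oz => hz.
have := @val_1D _ _ hv _ hz; by rewrite addrC subrK.
Qed.

(** In lowest terms, an even denominator comes with an odd numerator, against integrality. So the
    denominator is odd, with residue 1, and the numerator has its parity as residue. *)
Lemma rat_residue (q : rat) : val_ring v (in_alg F q) ->
  val_ge v 1 (in_alg F q - (~~ (2 %| numq q)%Z)%:R).
Proof.
have qE : in_alg F q = (numq q)%:~R / (denq q)%:~R.
  by rewrite -{1}(divq_num_den q) fmorph_div !rmorph_int.
have cop : ~~ ((2 %| numq q)%Z && (2 %| denq q)%Z).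
  apply/negP => /andP[h1 h2]; have := coprime_num_den q.
  rewrite /coprime => /eqP g1; have : (2 %| gcdn `|numq q| `|denq q|)%N.
    by rewrite dvdn_gcd; move: h1 h2; rewrite !dvdzE => -> ->.
  by rewrite g1.
rewrite qE => hq.
have [oden|] := boolP (~~ (2 %| denq q)%Z); last first.
  rewrite negbK => eden; rewrite eden andbT in cop.
  have [a0 va] := odd_int_unit cop.
  have b0 : (denq q)%:~R != 0 :> F.
    by rewrite -(rmorph_int (in_alg F)) fmorph_eq0 intr_eq0 denq_eq0.
  have vb : val_ge v 1 (denq q)%:~R.
    by have := int_residue (denq q); rewrite eden subr0.
  move: hq; rewrite /val_ring val_ge_neq0 ?mulf_neq0 ?invr_eq0 //.
  rewrite (val_div hv) // va sub0r oppr_ge0; move/(val_ge_neq0 _ _ b0): vb.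
  by move=> h1 h2; have := le_trans h1 h2.
have [b0 vb] := odd_int_unit oden.
have key (a b c : F) : b != 0 -> a / b - c = (a - c - c * (b - 1)) / b.
  by move=> b'0; field.
have vb1 := int_residue (denq q); rewrite oden in vb1; rewrite key //.
apply: (val_ringMr hv); last by right; rewrite (val_V hv) // vb.
apply: (val_geB hv); first exact: int_residue.
by apply: (val_ringMl hv) vb1; apply: val_ge_nat.
Qed.

(* Hence the residue field has dimension at most [F : Q] over its prime
   field. *)
Lemma number_field_residue_dependent n (x : 'I_n -> F) :
  (\dim {:F} < n)%N -> (forall i, val_ring v (x i)) ->
  exists c : 'I_n -> bool,
    (exists i, c i) /\ val_ge v 1 (\sum_i (c i)%:R * x i).
Proof.
move=> n_gt hx.
have [k [k0 [i0 ki0]]] : exists k : 'I_n -> rat,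
    \sum_i k i *: x i = 0 /\ exists i, k i != 0.
  apply: NNPP => hn.
  have : free [tuple x i | i < n].
    apply/freeP => k e i; apply: contra_not_eq hn => ki; exists k; split.
      by rewrite -[RHS]e; apply: eq_bigr => j _; rewrite -tnth_nth tnth_mktuple.
    by exists i.
  move/eqP; rewrite size_tuple => e.
  by have := dimvS (subvf <<[tuple x i | i < n]>>%VS); rewrite e leqNgt n_gt.
(* Dividing by a coefficient of least valuation makes all coefficients integral and one of them 1,
   so the reduced relation is nontrivial. *)
have [j kj jmin] := @arg_minP _ _ _ i0 (fun i => k i != 0)
  (fun i => v (in_alg F (k i))) ki0.
pose b i := k i / k j.
exists (fun i => ~~ (2 %| numq (b i))%Z); split.
  by exists j; rewrite /b divff.
have hb i : val_ring v (in_alg F (b i)).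
  rewrite /b; have [->|ki] := eqVneq (k i) 0.
    by left; rewrite mul0r rmorph0.
  right; rewrite fmorph_div (val_div hv) ?fmorph_eq0 // subr_ge0.
  exact: jmin.
have e : \sum_i in_alg F (b i) * x i = 0.
  transitivity ((k j)^-1 *: \sum_i k i *: x i); last by rewrite k0 scaler0.
  rewrite scaler_sumr; apply: eq_bigr => i _.
  by rewrite mulr_algl scalerA mulrC.
have -> : \sum_i (~~ (2 %| numq (b i))%Z)%:R * x i =
   - \sum_i (in_alg F (b i) - (~~ (2 %| numq (b i))%Z)%:R) * x i.
  rewrite -sumrN -[LHS]subr0 -[X in _ - X = _]e -sumrB.
  by apply: eq_bigr => i _; ring.
apply: (val_geN hv); apply: (val_ge_sum hv) => i _.
by apply: (val_ringMr hv) => //; apply: rat_residue.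
Qed.
End RationalResidue.

(** * Residue field and Hensel property of the completion *)

Section Completion.
Variables (F : fieldExtType rat) (v : F -> int).
Variables (K : fieldType) (iota : {rmorphism F -> K}) (w : K -> int).
Hypothesis hv : valuation v.
Hypothesis val_2 : val_ge v 1 2.
Hypothesis Kw : completion v iota w.
Let hw : valuation w := compl_val Kw.

Lemma val_ge_compl n x : val_ge w n (iota x) <-> val_ge v n x.
Proof.
have [->|x0] := eqVneq x 0; first by rewrite rmorph0; split; left.
by rewrite !val_ge_neq0 ?fmorph_eq0 // (compl_ext Kw).
Qed.

Lemma compl_val_2 : val_ge w 1 2.
Proof. by rewrite -(rmorph_nat iota) val_ge_compl. Qed.

(** By density, each x i has the residue of an element of F. *)
Lemma residue_dependent n (x : 'I_n -> K) :
  (\dim {:F} < n)%N -> (forall i, val_ring w (x i)) ->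
  exists c : 'I_n -> bool,
    (exists i, c i) /\ val_ge w 1 (\sum_i (c i)%:R * x i).
Proof.
move=> n_gt hx.
have [y hy] : exists y : 'I_n -> F, forall i, val_ge w 1 (x i - iota (y i)).
  apply: (@fin_all_exists _ (fun=> F)
             (fun i t => val_ge w 1 (x i - iota t))) => i.
  exact: (compl_dense Kw (x i) 1).
have [|c [hc hcy]] := number_field_residue_dependent hv val_2 (x := y) n_gt.
  move=> i; apply/val_ge_compl; rewrite -[iota _](subKr (x i)).
  by apply: (val_geB hw); [exact: hx | apply: val_geW (hy i)].
exists c; split=> //.
have -> : \sum_i (c i)%:R * x i =
    \sum_i (c i)%:R * (x i - iota (y i)) + iota (\sum_i (c i)%:R * y i).
  rewrite rmorph_sum -big_split; apply: eq_bigr => i _ /=.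
  by rewrite rmorphM rmorph_nat; ring.
apply: (val_add hw); last exact/val_ge_compl.
by apply: (val_ge_sum hw) => i _; apply: (val_ringMl hw) => //; apply: val_ge_nat.
Qed.

Lemma residue_sum_integral n (c : 'I_n -> bool) (y : nat -> K) :
  (forall i, val_ring w (y i)) -> val_ring w (\sum_i (c i)%:R * y i).
Proof.
move=> hy; apply: (val_ge_sum hw) => i _.
by apply: (val_ringM hw) => //; apply: val_ge_nat.
Qed.

(** Squaring is additive modulo 2 and fixes the coefficients 0 and 1. *)
Lemma residue_frobenius n (c : 'I_n -> bool) (y : nat -> K) :
  (forall i, val_ring w (y i)) ->
  val_ge w 1 ((\sum_i (c i)%:R * y i) ^+ 2 - \sum_i (c i)%:R * y i ^+ 2).
Proof.
elim: n c y => [|n IHn] c y hy; first by left; rewrite !big_ord0 expr0n subr0.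
rewrite !big_ord_recl [nat_of_ord ord0]/=.
set s := \sum_(i < n) _; set s' := \sum_(i < n) _.
have -> : ((c ord0)%:R * y 0%N + s) ^+ 2 - ((c ord0)%:R * y 0%N ^+ 2 + s') =
   2 * ((c ord0)%:R * y 0%N * s) + (s ^+ 2 - s').
  by case: (c ord0) => /=; rewrite ?mulr1n ?mulr0n; ring.
apply: (val_add hw).
  apply: (val_ringMr hw); first exact: compl_val_2.
  apply: (val_ringM hw).
    by apply: (val_ringM hw) => //; apply: val_ge_nat.
  exact: (residue_sum_integral (fun i => c (lift ord0 i)) (fun i => hy i.+1)).
exact: (IHn (fun i => c (lift ord0 i)) (fun i => y i.+1)).
Qed.

(** The powers x, x^2, x^4, ... satisfy a residual relation with coefficients 0 and 1. If x occurs
    in it, x is residually a sum of squares, hence a square; otherwise the relation is residually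
    the square of a shorter one. *)
Lemma residue_perfect x : val_ring w x ->
  exists2 y, val_ring w y & val_ge w 1 (x - y ^+ 2).
Proof.
move=> hx.
have key n (c : 'I_n -> bool) : (exists i, c i) ->
    val_ge w 1 (\sum_i (c i)%:R * x ^+ (2 ^ i)) ->
    exists2 y, val_ring w y & val_ge w 1 (x - y ^+ 2).
  elim: n c => [|n IHn] c [i ci]; first by case: i ci.
  rewrite big_ord_recl expn0 expr1.
  pose y i := x ^+ (2 ^ i).
  pose c' i := c (lift ord0 i).
  have hy j : val_ring w (y j) by apply: (val_ringX hw).
  have -> : \sum_(i < n) (c (lift ord0 i))%:R * x ^+ (2 ^ lift ord0 i) =
            \sum_(i < n) (c' i)%:R * y i ^+ 2.
    by apply: eq_bigr => j _; rewrite /y -exprM -expnSr.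
  have := residue_frobenius c' hy; set s := \sum_(i < n) _; set s' := \sum_(i < n) _.
  have hs : val_ring w s by apply: residue_sum_integral.
  case c0 : (c ord0) => hs' hc.
    exists s => //.
    have -> : x - s ^+ 2 = x + s' - (s ^+ 2 - s') - 2 * s' by ring.
    apply: (val_geB hw); first by apply: (val_geB hw) => //; rewrite -[x]mul1r.
    apply: (val_ringMr hw); first exact: compl_val_2.
    apply: (residue_sum_integral c' (y := fun i => y i ^+ 2)) => j.
    exact: (val_ringX hw).
  have hs2 : val_ge w 1 (s ^+ 2).
    rewrite mul0r add0r in hc.
    by have := val_add hw hs' hc; rewrite subrK.
  apply: (IHn c'); last exact: val_ge_sqr hs2.
  case: (unliftP ord0 i) ci => [j -> cj|->]; last by rewrite c0.
  by exists j.
have [|c [hc hcx]] := residue_dependent (x := fun i => x ^+ (2 ^ i)) (ltnSn _).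
  by move=> i; apply: (val_ringX hw).
exact: key hc hcx.
Qed.

(* Otherwise [P x = x^2 + x] is surjective on the residue field, so there is
   an infinite sequence of residues starting with 1, each being the image
   under [P] of the next.  As [P] is additive and [P 1 = 0], these are
   linearly independent over the prime field. *)
Lemma exists_artin_schreier : exists rho, artin_schreier w rho.
Proof.
apply: NNPP => nex.
have surj r : val_ring w r ->
    exists2 x, val_ring w x & val_ge w 1 (x ^+ 2 + x - r).
  move=> hr; apply: NNPP => nx; apply: nex; exists r; split=> // x hx h.
  by apply: nx; exists x.
have chain n : exists x : nat -> K, [/\ x 0 = 1, forall i, val_ring w (x i) &
    forall i, (i < n)%N -> val_ge w 1 (x i.+1 ^+ 2 + x i.+1 - x i)].
  elim: n => [|n [x [x0 hx hxS]]].
    by exists (fun=> 1); split=> // i; apply: val_ring1.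
  have [t ht htx] := surj _ (hx n).
  exists (fun i => if (i <= n)%N then x i else t); split=> // [i|i].
    by case: ifP.
  rewrite ltnS leq_eqVlt => /predU1P[->|lt_in].
    by rewrite eqxx ltnn.
  by rewrite lt_in orbT; apply: hxS.
have [x [x0 hx hxS]] := chain (\dim {:F}).+1.
have indep n (c : 'I_n -> bool) : (n <= (\dim {:F}).+1)%N ->
    val_ge w 1 (\sum_i (c i)%:R * x i) -> forall i, ~~ c i.
  elim: n c => [|n IHn] c hn hs i; first by case: i.
  have hy k : val_ring w (x k ^+ 2) by apply: (val_ringX hw).
  pose c' j := c (lift ord0 j).
  (* Applying X^2 + X to the relation sends x (j + 1) to x j and kills x 0 = 1 modulo 2, which
     leaves a shorter relation. *)
  have hc' : val_ge w 1 (\sum_j (c' j)%:R * x j).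
    have -> : \sum_j (c' j)%:R * x j =
      (\sum_j (c j)%:R * x j) ^+ 2 + \sum_j (c j)%:R * x j
      - ((\sum_j (c j)%:R * x j) ^+ 2 - \sum_j (c j)%:R * x j ^+ 2)
      - (2 * (c ord0)%:R +
         \sum_j (c' j)%:R * (x j.+1 ^+ 2 + x j.+1 - x j)).
      have -> : \sum_j (c' j)%:R * (x j.+1 ^+ 2 + x j.+1 - x j) =
          \sum_j (c' j)%:R * x j.+1 ^+ 2 + \sum_j (c' j)%:R * x j.+1
          - \sum_j (c' j)%:R * x j.
        by rewrite -big_split -sumrB; apply: eq_bigr => j _ /=; ring.
      rewrite [X in _ + X - _ - _]big_ord_recl.
      rewrite [X in _ - (_ - X)]big_ord_recl /= x0 expr1n.
      by case: (c ord0) => /=; rewrite ?mulr1n ?mulr0n; ring.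
    have h1 : val_ge w 1 ((\sum_j (c j)%:R * x j) ^+ 2 + \sum_j (c j)%:R * x j).
      apply: (val_add hw) => //; rewrite expr2; apply: (val_ringMr hw) => //.
      exact: val_geW hs.
    apply: (val_geB hw); last apply: (val_add hw).
    - by apply: (val_geB hw) => //; apply: residue_frobenius.
    - apply: (val_ringMr hw); first exact: compl_val_2.
      exact: val_ge_nat.
    apply: (val_ge_sum hw) => j _; apply: (val_ringMl hw).
      exact: val_ge_nat.
    by apply: hxS; apply: leq_trans hn; apply: leqW (ltn_ord j).
  have {}IHn := IHn c' (ltnW hn) hc'.
  case: (unliftP ord0 i) => [j ->|->]; first exact: IHn.
  apply/negP => c0; move: hs; rewrite big_ord_recl c0 x0 mulr1 big1 ?addr0.
    by rewrite val_ge_neq0 ?oner_eq0 // (val_1 hw).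
  by move=> j _; have := IHn j; rewrite /c' => /negPf ->; rewrite mul0r.
have [c [[i ci] hc]] := residue_dependent (ltnSn _) (fun i => hx (nat_of_ord i)).
by have := indep _ c (leqnn _) hc i; rewrite ci.
Qed.

(* The fixed point iteration y <- x - y^2. *)
Lemma compl_henselian x : val_ge w 1 x ->
  exists2 y, val_ge w 1 y & y ^+ 2 + y = x.
Proof.
move=> hx.
pose y n := iter n (fun t => x - t ^+ 2) x.
have yS n : y n.+1 = x - y n ^+ 2 by [].
have ym n : val_ge w 1 (y n).
  elim: n => [//|n IHn]; rewrite yS; apply: (val_geB hw) => //.
  by rewrite expr2; apply: (val_ringMr hw) => //; apply: val_geW IHn.
(* The next difference is minus this one times a sum of two iterates, which adds at least 1 to the
   valuation. *)
have ystep n : val_ge w (n%:Z + 1) (y n.+1 - y n).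
  elim: n => [|n IHn]; first by apply: (val_geB hw).
  have -> : y n.+2 - y n.+1 = - ((y n.+1 - y n) * (y n.+1 + y n)).
    by rewrite !yS; ring.
  have -> : n.+1%:Z + 1 = n%:Z + 1 + 1 by lia.
  apply: (val_geN hw); apply: (val_geM hw) => //.
  by apply: (val_add hw); apply: ym.
have ydist N k : val_ge w N%:Z (y (N + k)%N - y N).
  elim: k => [|k IHk]; first by left; rewrite addn0 subrr.
  have -> : y (N + k.+1)%N - y N =
            (y (N + k).+1 - y (N + k)%N) + (y (N + k)%N - y N).
    by rewrite addnS; ring.
  apply: (val_add hw) => //; apply: val_geW (ystep _); lia.
have [l hl] : exists l, val_cvg w y l.
  apply: (compl_complete Kw) => n; exists `|n|%N => i j hi hj.
  have h k : (`|n| <= k)%N -> val_ge w n (y k - y `|n|%N).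
    by move=> /subnKC <-; apply: val_geW (ydist _ _); lia.
  have -> : y i - y j = (y i - y `|n|%N) - (y j - y `|n|%N) by ring.
  by apply: (val_geB hw); apply: h.
have lm : val_ge w 1 l.
  have [N hN] := hl 1; rewrite -[l](subKr (y N)).
  by apply: (val_geB hw) => //; apply: hN.
(* A nonzero error l^2 + l - x would have a valuation greater than its own, as y N and y (N + 1) are
   close to l. *)
exists l => //; apply/eqP; rewrite -subr_eq0; apply/negP => /negP z0.
have [N hN] := hl (w (l ^+ 2 + l - x) + 1).
have zE : l ^+ 2 + l - x = - ((y N - l) * (l + y N)) - (y N.+1 - l).
  by rewrite yS; ring.
have : val_ge w (w (l ^+ 2 + l - x) + 1) (l ^+ 2 + l - x).
  rewrite [X in val_ge _ _ X]zE; apply: (val_geB hw); last exact: hN.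
  apply: (val_geN hw); apply: (val_ringMr hw); first exact: hN.
  by apply: val_geW (val_add hw lm (ym N)).
by rewrite val_ge_neq0 //; lia.
Qed.
End Completion.

(** * Normalization of the valuation *)

(** Divide [w] by its least positive value g, attained at [pi]; the valuation ring and its maximal
    ideal do not change. *)
Lemma exists_normalized (K : fieldType) (w : K -> int) :
  valuation w -> 2 != 0 :> K -> 1 <= w 2 ->
  exists (u : K -> int) (pi : K), [/\ valuation u, pi != 0, u pi = 1,
    forall x, val_ring u x <-> val_ring w x &
    forall x, val_ge u 1 x <-> val_ge w 1 x].
Proof.
move=> hw two0 w2.
have [g [pi [g_gt0 pi0 wpi gmin]]] : exists (g : nat) (pi : K),
    [/\ (0 < g)%N, pi != 0, w pi = g &
     forall x, x != 0 -> 0 < w x -> g%:Z <= w x].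
  have : exists2 x : K, x != 0 & w x = absz (w 2) by exists 2 => //; lia.
  have : (0 < absz (w 2%R))%N by lia.
  elim/ltn_ind: (absz (w 2)) => n IHn n_gt0 [x x0 wx].
  have [[y [y0 y_gt0 y_lt]]|nmin] :=
      classic (exists y, [/\ y != 0, 0 < w y & w y < n%:Z]).
    by apply: (IHn `|w y|%N); [lia | lia | exists y => //; lia].
  exists n, x; split=> // y y0 y_gt0; rewrite leNgt; apply/negP => y_lt.
  by apply: nmin; exists y.
have g0 : g%:Z != 0 by lia.
(* The quotient x / pi^k has valuation w x mod g, which is below g and hence 0 by minimality. *)
have wE x : x != 0 -> w x = (w x %/ g)%Z * g%:Z.
  move=> x0; pose k := (w x %/ g)%Z.
  have pik : pi ^ k != 0 by rewrite expfz_neq0.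
  have wr : w (x / pi ^ k) = (w x %% g)%Z.
    rewrite (val_div hw) // (val_expz hw) // wpi {1}(divz_eq (w x) g) -/k; ring.
  have := modz_ge0 (w x) g0; have := ltz_pmod (w x) (g_gt0 : 0 < g%:Z).
  have := gmin (x / pi ^ k); rewrite wr mulf_neq0 ?invr_eq0 // => /(_ isT).
  by have := divz_eq (w x) g; lia.
have uE n x : x != 0 -> n <= (w x %/ g)%Z <-> n * g%:Z <= w x.
  by move=> x0; rewrite {2}(wE x x0) ler_pM2r //; lia.
have geE n x : val_ge (fun x => (w x %/ g)%Z) n x <-> val_ge w (n * g%:Z) x.
  have [->|x0] := eqVneq x 0; first by split; left.
  by rewrite !val_ge_neq0 //; apply: uE.
exists (fun x => (w x %/ g)%Z), pi; split=> //.
- split=> [x y x0 y0|n x y /geE hx /geE hy].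
    by rewrite (val_mul hw) // (wE x x0) (wE y y0) -mulrDl !mulzK.
  by apply/geE; apply: (val_add hw).
- by rewrite wpi divzz g0.
- by move=> x; rewrite /val_ring geE mul0r.
- move=> x; rewrite geE mul1r.
  have [->|x0] := eqVneq x 0; first by split; left.
  rewrite !val_ge_neq0 //; split=> h; first by lia.
  by apply: gmin => //; lia.
Qed.

(** * Binary lattices with a given Gram matrix *)

Section BinaryLattice.
Variables (K : fieldType) (a b c : K).

Definition binary_form (x y : 'rV[K]_2) : K :=
  a * x 0 0 * y 0 0 + b * (x 0 0 * y 0 1 + x 0 1 * y 0 0) + c * x 0 1 * y 0 1.

Lemma binary_form_bilinear :
  bilinear_for (GRing.Scale.Law.clone _ _ *%R _)
    (GRing.Scale.Law.clone _ _ (idfun \; *%R) _) binary_form.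
Proof.
by split=> [z|z] k x y; rewrite /binary_form /= !mxE; ring.
Qed.

HB.instance Definition _ := bilinear_isBilinear.Build K _ _ _ _ _ binary_form
  binary_form_bilinear.

Lemma binary_form_sym x y :
  binary_form x y = (-1) ^+ false * idfun (binary_form y x).
Proof. by rewrite /binary_form /=; ring. Qed.

HB.instance Definition _ :=
  isHermitianSesquilinear.Build K _ false idfun binary_form binary_form_sym.

Lemma binary_form_nondegenerate :
  a * c - b ^+ 2 != 0 -> nondegenerate (binary_form : {symmetric _}).
Proof.
move=> D0; rewrite /nondegenerate -subv0; apply/subvP => x /mem_orthovP hx.
have /= h0 := hx (delta_mx 0 0) (memvf _).
have /= h1 := hx (delta_mx 0 1) (memvf _).
rewrite /binary_form !mxE /= !mulr1 !mulr0 !addr0 add0r in h0.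
rewrite /binary_form !mxE /= !mulr1 !mulr0 addr0 add0r in h1.
have x0 : x 0 0 * (a * c - b ^+ 2) = 0.
  transitivity ((a * x 0 0 + b * x 0 1) * c - (b * x 0 0 + c * x 0 1) * b).
    by ring.
  by rewrite h0 h1 !mul0r subr0.
have x1 : x 0 1 * (a * c - b ^+ 2) = 0.
  transitivity ((b * x 0 0 + c * x 0 1) * a - (a * x 0 0 + b * x 0 1) * b).
    by ring.
  by rewrite h0 h1 !mul0r subr0.
move/eqP: x0; rewrite mulf_eq0 (negPf D0) orbF => /eqP x0.
move/eqP: x1; rewrite mulf_eq0 (negPf D0) orbF => /eqP x1.
rewrite memv0; apply/eqP/rowP => i; rewrite mxE.
by case: i => [[|[|//]] hi]; [rewrite -[RHS]x0 | rewrite -[RHS]x1];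
  congr (x _ _); apply: val_inj.
Qed.

End BinaryLattice.

Lemma rV2_sum_delta (K : fieldType) (x : 'rV[K]_2) :
  x = x 0 0 *: delta_mx 0 0 + x 0 1 *: delta_mx 0 1.
Proof.
rewrite {1}(row_sum_delta x) !big_ord_recl big_ord0 addr0.
by congr (_ *: _ + x _ _ *: delta_mx _ _); apply: val_inj.
Qed.

Lemma standard_lattice_fin_gen (K : fieldType) (v : K -> int) :
  exists s : seq 'rV[K]_2, <<s>>%VS = fullv /\
    forall x : 'rV[K]_2, (forall i, val_ring v (x 0 i)) <->
      exists k : nat -> K, (forall i, val_ring v (k i)) /\
        x = \sum_(i < size s) k i *: s`_i.
Proof.
exists [:: delta_mx 0 0; delta_mx 0 1]; split.
  apply/eqP; rewrite eqEsubv subvf /=; apply/subvP => x _.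
  by rewrite (rV2_sum_delta x) memvD // memvZ // memv_span // !inE eqxx ?orbT.
move=> x; split=> [hx|[k [hk ->]] i].
  exists (fun i => x 0 (inord i)); split=> //.
  rewrite {1}(rV2_sum_delta x) !big_ord_recl big_ord0 addr0 /=.
  by congr (x _ _ *: _ + x _ _ *: _); apply: val_inj; rewrite /= inordK.
rewrite !big_ord_recl big_ord0 addr0 /= !mxE /=.
by case: i => [[|[|//]] hi] /=; rewrite !mulr1 !mulr0 ?addr0 ?add0r; apply: hk.
Qed.

(** Apply universality to O^2 with the given Gram matrix; a linear map preserving Q preserves B by
    polarization, as 2 is nonzero. *)
Lemma classic_universal_represents_binary (K : fieldType) (v : K -> int)
    (M : lattice v) (a b c : K) :
  valuation v -> 2 != 0 :> K -> classic_universal 2 M ->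
  val_ring v a -> val_ring v b -> val_ring v c -> a * c - b ^+ 2 != 0 ->
  represents_binary (lat_form M) M a b c.
Proof.
move=> hv two0 [_ hM] ha hb hc D0.
pose L := Lattice (binary_form_nondegenerate D0) (standard_lattice_fin_gen v).
have L_int : classic_integral L.
  move=> x y hx hy; apply: (val_add hv); last first.
    by apply: (val_ringM hv) => //; apply: (val_ringM hv).
  apply: (val_add hv); first by apply: (val_ringM hv) => //; apply: (val_ringM hv).
  apply: (val_ringM hv) => //.
  by apply: (val_add hv); apply: (val_ringM hv).
have L_rank : lat_rank L = 2 by rewrite /lat_rank dimvf /dim /= mul1n.
have [sigma [sQ sL]] := hM L L_int L_rank.
have sB x y : lat_form M (sigma x) (sigma y) = lat_form L x y.
  have e : lat_Q (sigma (x + y)) - lat_Q (sigma x) - lat_Q (sigma y) =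
           lat_Q (x + y : lat_space L) - lat_Q x - lat_Q y by rewrite !sQ.
  rewrite /lat_Q linearD !formE in e.
  rewrite [lat_form M (sigma y) _]formC [lat_form L y x]formC in e.
  apply: (mulfI two0); apply: etrans (etrans e _); ring.
have delta_int i : L (delta_mx 0 i).
  by move=> j; rewrite mxE eqxx; apply: val_ge_nat.
exists (sigma (delta_mx 0 0)), (sigma (delta_mx 0 1)); split.
- exact: sL.
- exact: sL.
- by rewrite sB /= /binary_form !mxE /=; ring.
- by rewrite sB /= /binary_form !mxE /=; ring.
- by rewrite sB /= /binary_form !mxE /=; ring.
Qed.

(** * Lattices over dyadic completions of number fields *)

Lemma lattice_lin (K : fieldType) (v : K -> int) (M : lattice v) a
    (x y : lat_space M) :
  valuation v -> val_ring v a -> M x -> M y -> M (x + a *: y).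
Proof.
move=> hv ha; have [s [_ hs]] := lat_fin_gen M.
move=> /hs [k [hk ->]] /hs [l [hl ->]]; apply/hs.
exists (fun i => k i + a * l i); split=> [i|].
  by apply: (val_add hv); [apply: hk | apply: (val_ringM hv)].
rewrite scaler_sumr -big_split; apply: eq_bigr => i _ /=.
by rewrite scalerDl scalerA.
Qed.

Theorem proposition4p6 (F : fieldExtType rat) (p : F -> Prop) (v : F -> int)
    (Fp : fieldType) (iota : {rmorphism F -> Fp}) (vp : Fp -> int) :
  prime_of p -> dyadic p -> padic_valuation p v -> completion v iota vp ->
  ~ exists M : lattice vp, lat_rank M = 4 /\ classic_universal 2 M.
Proof.
move=> p_prime p2 [hv v_exp] Kw [M [M_rank M_univ]].
have hw := compl_val Kw.
have two0 : 2 != 0 :> F.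
  have -> : 2 = in_alg F 2 by rewrite rmorph_nat.
  by rewrite fmorph_eq0.
have two0K : 2 != 0 :> Fp by rewrite -(rmorph_nat iota) fmorph_eq0.
have int2 : ring_of_integers (2 : F).
  exact: (integral_nat (intr : int -> F) 2).
have int1 : ring_of_integers (1 : F).
  exact: (integral_nat (intr : int -> F) 1).
(* Writing 2 as 2 times 1 puts it in the product of p with the ring of integers, the first power of
   p. *)
have v2 : 1 <= v 2.
  apply/(v_exp 2 1%N) => //; exists [:: (2, 1)]; split.
    by move=> ab; rewrite inE => /eqP ->.
  by rewrite big_seq1 mulr1.
have v2' : val_ge v 1 2 by right.
have w2 : 1 <= vp 2.
  by move: (compl_val_2 v2' Kw); rewrite val_ge_neq0.
(* From here on [u] replaces [vp], so that a uniformizer is at hand. *)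
have [u [pi [hu pi0 upi uO um]]] := exists_normalized hw two0K w2.
have [rho [rhoO rho_AS]] := exists_artin_schreier hv v2' Kw.
apply: (@not_all_binary _ u hu two0K _ pi rho pi0 upi _ _ _
          (lat_space M) (lat_form M) M (lat_nondegenerate M) M_rank).
- by move: w2; rewrite -!val_ge_neq0 // um.
- by split=> [|x /uO hx /um]; [apply/uO | apply: rho_AS].
- move=> x /uO /(residue_perfect hv v2' Kw) [y /uO hy /um hxy].
  by exists y.
- move=> x /um /(compl_henselian Kw) [y /um hy yE].
  by exists y.
- by move=> a x y /uO; apply: lattice_lin.
- by move=> x y Mx My; apply/uO; case: M_univ => + _; apply.
move=> a b c /uO ha /uO hb /uO hc.
exact: classic_universal_represents_binary.
Qed.
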